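(* The conjugacies $\sim_o$ and $\sim_c$ are partition covering for any countable set. The conjugacies $\sim_p$, $\sim_{p^*}$, and $\sim_{tr}$ are partition covering for any finite set.
   Context: A conjugacy relation $\sim$ (one defined on every semigroup of the relevant kind) is partition covering for a set $X$ if, for every partition of $X$, there exists a semigroup with universe $X$ such that the partition equals the set of $\sim$-conjugacy classes of that semigroup. Countable means finite or countably infinite. For a semigroup $S$, $S^1=S$ if $S$ is a monoid, and otherwise $S^1=S\cup\{1\}$ with $1$ an adjoined identity. For $a,b\in S$: - $a\sim_o b$ iff $ag=gb$ and $bh=ha$ for some $g,h\in S$. - If $S$ has a zero element $0$ (i.e. $0s=s0=0$ for all $s$), then for $a\neq 0$ put $\mathbb{P}(a)=\{g\in S: (ma)g\neq 0\text{ for all } ma\in S^1a\setminus\{0\}\}$, and $\mathbb{P}(0)=\{0\}$. If $S$ has no zero, $\mathbb{P}(a)=S$ for all $a$. Put $\mathbb{P}^1(a)=\mathbb{P}(a)\cup\{1\}$, where $1$ is the identity of $S^1$. Then $a\sim_c b$ iff $ag=gb$ and $bh=ha$ for some $g\in\mathbb{P}^1(a)$ and some $h\in\mathbb{P}^1(b)$. - $a\sim_p b$ iff $a=uv$ and $b=vu$ for some $u,v\in S^1$; $\sim_{p^*}$ is the transitive closure of $\sim_p$. - For finite $S$, $a\sim_{tr}b$ iff there are $g,h\in S$ with $ghg=g$, $hgh=h$, $hg=a^\omega$, $gh=b^\omega$ and $ga^{\omega+1}h=b^{\omega+1}$, where $\omega\ge 1$ is such that $s^\omega$ is idempotent for all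 $s\in S$. *)

(* Defs.v *)
From HB Require Import structures.
From mathcomp Require Import all_boot.
From mathcomp Require Import boolp classical_sets functions cardinality.
From Stdlib Require Export Relation_Definitions Relation_Operators.

Set Implicit Arguments.
Unset Strict Implicit.
Unset Printing Implicit Defensive.

Local Open Scope classical_set_scope.

(* A semigroup with universe [T] is an associative operation
   [op : SemiGroup.law T] (MathComp's bigop.v). *)

Section Semigroup.
Variables (T : Type) (op : SemiGroup.law T).

Definition is_identity (e : T) : Prop := left_id e op /\ right_id e op.

Definition is_monoid : Prop := exists e, is_identity e.

Definition is_zero (z : T) : Prop := left_zero z op /\ right_zero z op.

(* S^1 is represented inside [option T]: [Some s] stands for s in S, and [None]
   for the adjoined identity, which belongs to S^1 only if S is not a monoid. *)
Definition S1 : set (option T) :=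
  [set u | match u with Some _ => True | None => ~ is_monoid end].

Definition mul1 (u v : option T) : option T :=
  match u, v with
  | Some x, Some y => Some (op x y)
  | None, _ => v
  | _, None => u
  end.

Definition is_one1 (u : option T) : Prop :=
  S1 u /\ forall v, S1 v -> mul1 u v = v /\ mul1 v u = v.

(* There is at most one zero [z], so quantifying over it universally makes this
   the whole of S when S has no zero. *)
Definition PP (a : T) : set T :=
  [set g | forall z, is_zero z ->
     (a = z -> g = z) /\
     (a <> z -> forall m, S1 m -> mul1 m (Some a) <> Some z ->
        mul1 (mul1 m (Some a)) (Some g) <> Some z)].

Definition PP1 (a : T) : set (option T) :=
  [set u | (exists2 g, PP a g & u = Some g) \/ is_one1 u].

(* s ^ n for n >= 1; only used for such n *)
Definition spow (s : T) (n : nat) : T := iterop n op s s.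

Definition is_omega (w : nat) : Prop :=
  (0 < w)%N /\ forall s, op (spow s w) (spow s w) = spow s w.

End Semigroup.

Definition conj_o (T : Type) (op : SemiGroup.law T) (a b : T) : Prop :=
  exists g h, op a g = op g b /\ op b h = op h a.

Definition conj_c (T : Type) (op : SemiGroup.law T) (a b : T) : Prop :=
  exists g h, [/\ PP1 op a g, PP1 op b h,
    mul1 op (Some a) g = mul1 op g (Some b) &
    mul1 op (Some b) h = mul1 op h (Some a)].

Definition conj_p (T : Type) (op : SemiGroup.law T) (a b : T) : Prop :=
  exists u v, [/\ S1 op u, S1 op v, Some a = mul1 op u v & Some b = mul1 op v u].

Definition conj_pstar (T : Type) (op : SemiGroup.law T) : T -> T -> Prop :=
  clos_trans T (conj_p op).

(* Meant for finite T, where an [w] as below exists and s ^ w, s ^ (w + 1) do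
   not depend on it. *)
Definition conj_tr (T : Type) (op : SemiGroup.law T) (a b : T) : Prop :=
  exists2 w, is_omega op w & exists g h,
    [/\ op (op g h) g = g,
        op (op h g) h = h,
        op h g = spow op a w,
        op g h = spow op b w &
        op (op g (spow op a w.+1)) h = spow op b w.+1].

Definition conjugacy := forall T : Type, SemiGroup.law T -> T -> T -> Prop.

Definition conj_classes (T : Type) (R : T -> T -> Prop) : set (set T) :=
  range (fun a => [set b | R a b]).

(* Speaking of conjugacy classes presupposes an equivalence relation on the
   semigroup at hand ([conj_p] is not transitive in general). *)
Definition partition_covering (R : conjugacy) (X : Type) : Prop :=
  forall P : set (set X), partition P id [set: X] ->
    exists op : SemiGroup.law X,
      equivalence X (R X op) /\ P = conj_classes (R X op).

(* Main.v *)
(** For [~p], [~p*] and [~tr], enumerate the blocks of the partition and let the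
    product be the minimum, ties being resolved in favour of the left factor:
    this is a chain of left zero bands, one for each block. In a left zero band
    all elements are conjugate, and [u v], [v u] always lie in the same band.

    For [~o] and [~c] with at least two blocks, label the blocks by the elements
    of Z/kZ (or of the monoid N, if there are infinitely many), and let the
    product of [x] and [y] be a representative of the block labelled by the sum
    of their labels. By cancellation and commutativity, [a g = g b] forces equal
    labels; conversely [a a = a b = b a] for equal labels. There is no zero, as
    it would make all elements [~o]-conjugate, so [~c] is [~o]. The one-block
    partition comes from a left zero band. *)

From HB Require Import structures.
Require Import Defs.
From mathcomp Require Import all_boot.
From mathcomp Require Import boolp classical_sets functions cardinality.

Set Implicit Arguments.
Unset Strict Implicit.
Unset Printing Implicit Defensive.

Local Open Scope classical_set_scope.
Local Open Scope card_scope.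

(* With [k = 0], reduction modulo [k] is the identity, and the labels of the
   blocks are all the natural numbers. *)
Lemma partition_labelling (X : Type) (P : set (set X)) :
  countable [set: X] -> partition P id [set: X] ->
  exists (c : X -> nat) (k : nat),
    [/\ P = conj_classes (fun a b => c a = c b),
        forall x, c x %% k = c x
      & forall (x0 : X) n, exists x, c x = n %% k].
Proof.
move=> cX [Pcover Ptriv Pne].
have /choice[pi piP] x : exists A, P A /\ A x.
  by have : [set: X] x by []; rewrite -Pcover => -[A PA Ax]; exists A.
have piE A x : P A -> A x -> pi x = A.
  by move=> PA Ax; have [Ppi pix] := piP x; apply: Ptriv => //; exists x.
have PE : P = range pi.
  apply/seteqP; split=> [A PA|_ [x _ <-]]; last by case: (piP x).
  by have [x Ax] := Pne A PA; exists x => //; exact: piE.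
have cP : countable P.
  by rewrite PE; apply: (card_le_trans (card_image_le _ _)).
(* [f] numbers the blocks by the naturals below [k], or by all of them if [k = 0]. An empty [P] has
   size 0 as well and would be mistaken for the infinite case, so surjectivity is claimed only for
   inhabited [X]. *)
have [k [f [fS fI fO]]] : exists k (f : set X -> nat),
    [/\ forall A, P A -> k = 0 \/ f A < k, set_inj P f
      & X -> set_surj P [set n | k = 0 \/ n < k] f].
  have [[k /card_set_bijP[f [fS fI fO]]]|Pinf] := pselect (finite_set P).
    exists k, f; split=> // [A PA|x n [k0|//]]; first by right; exact: fS.
      by have [/fS] := piP x; rewrite k0.
    exact: fO.
  have /card_set_bijP[f [fS fI fO]] := eq_card_nat cP Pinf.
  by exists 0, f; split=> // [A _|x n _]; [left|exact: fO].
exists (f \o pi), k; split.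
- rewrite PE /conj_classes; apply: (congr1 (fun g => range g)).
  apply/funext => a; apply/seteqP; split=> b /= => [ab|fab].
    by have [Pa _] := piP a; rewrite (piE _ _ Pa ab).
  have [Pa _] := piP a; have [Pb pib] := piP b.
  by rewrite (fI _ _ _ _ fab) ?inE.
- move=> x /=; have [Px _] := piP x.
  by case: (fS _ Px) => [->|/modn_small//]; rewrite modn0.
- move=> x0 n.
  have [|A PA fA] := fO x0 (n %% k).
    by case: k {fS fO} => [|k] /=; [left|right; rewrite ltn_mod].
  by have [x Ax] := Pne A PA; exists x; rewrite /= (piE A).
Qed.

Lemma covering_labelling (R : conjugacy) (X : Type) (op : SemiGroup.law X)
    (c : X -> nat) (P : set (set X)) :
  P = conj_classes (fun a b => c a = c b) ->
  (forall a b, R X op a b <-> c a = c b) ->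
  equivalence X (R X op) /\ P = conj_classes (R X op).
Proof.
move=> -> RE.
have -> : R X op = (fun a b => c a = c b).
  by apply/funext => a; apply/funext => b; apply/propext.
by split=> //; split=> [a|a b d ->|a b ->].
Qed.

Section ChainOfLeftZeroBands.
Variables (X : Type) (c : X -> nat).

Definition chain_op (x y : X) := if c x <= c y then x else y.

(** Either bracketing selects the leftmost of the factors with least label. *)
Lemma chain_opA : associative chain_op.
Proof.
move=> x y z; rewrite /chain_op.
case: (leqP (c y) (c z)) => [yz|zy]; case: (leqP (c x) (c y)) => [xy|yx].
- by rewrite (leq_trans xy yz).
- by rewrite yz.
- by [].
- by rewrite leqNgt (ltn_trans zy yx) /= leqNgt zy.
Qed.

HB.instance Definition _ := SemiGroup.isLaw.Build X chain_op chain_opA.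

Definition chain_law : SemiGroup.law X := chain_op.

Lemma chain_opl x y : c x = c y -> chain_op x y = x.
Proof. by rewrite /chain_op => ->; rewrite leqnn. Qed.

Lemma label_chain_opC x y : c (chain_op x y) = c (chain_op y x).
Proof. by rewrite /chain_op; case: (ltngtP (c x) (c y)). Qed.

Lemma spow_chain a n : 0 < n -> spow chain_law a n = a.
Proof.
rewrite /spow; case: n => // n _; elim: n => // n IHn.
by rewrite iteropS iterS -(iteropS a) IHn; exact: chain_opl.
Qed.

Lemma conj_p_chain a b : conj_p chain_law a b <-> c a = c b.
Proof.
split=> [[[u|] [[v|] [_ _ /= + +]]]|cab].
- by move=> [->] [->]; exact: label_chain_opC.
- by move=> [->] [->].
- by move=> [->] [->].
- by [].
- exists (Some a), (Some b); split=> //=; congr Some.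
    by rewrite chain_opl.
  by rewrite chain_opl.
Qed.

(** Equality of labels is already transitive, so the closure adds nothing. *)
Lemma conj_pstar_chain a b : conj_pstar chain_law a b <-> c a = c b.
Proof.
split=> [|/conj_p_chain]; last exact: t_step.
by elim=> [x y /conj_p_chain//|x y z _ -> _ ->].
Qed.

Lemma conj_tr_chain a b : conj_tr chain_law a b <-> c a = c b.
Proof.
split=> [[w [w0 _] [g [h [_ _]]]]|cab].
  (* Powers collapse by idempotency, leaving [a = hg] and [b = gh]. *)
  by rewrite !spow_chain// => <- <- _; exact: label_chain_opC.
exists 1; first by split=> // s; exact: chain_opl.
exists b, a; rewrite !spow_chain//=.
by split; rewrite !chain_opl // ?chain_opl.
Qed.

Hypothesis c_const : forall x y, c x = c y.

Lemma conj_o_chain a b : conj_o chain_law a b.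
Proof. by exists a, b; rewrite /= !chain_opl. Qed.

Lemma conj_c_chain a b : conj_c chain_law a b.
Proof.
(* In a left zero band [y z = y], so a zero [z] exists only if [z] is the sole element; the
   restriction on [g] is then void. *)
have PPT x g : PP chain_law x g.
  move=> z [_ z0].
  have all_z y : y = z by rewrite -(z0 y) /= chain_opl.
  by split=> [_|]; [exact: all_z|rewrite (all_z x)].
exists (Some a), (Some b); split; rewrite /= ?chain_opl//; left.
- by exists a.
- by exists b.
Qed.

End ChainOfLeftZeroBands.

Section LabelsAddition.
Variables (X : Type) (c : X -> nat) (k : nat) (r : nat -> X).
Hypotheses (c_mod : forall x, c x %% k = c x) (rK : forall n, c (r n) = n %% k).

Definition label_add (x y : X) := r ((c x + c y) %% k).

Lemma label_addE x y : c (label_add x y) = (c x + c y) %% k.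
Proof. by rewrite rK modn_mod. Qed.

Lemma label_addA : associative label_add.
Proof.
move=> x y z; rewrite {1 3}/label_add !label_addE.
by rewrite modnDml modnDmr addnA.
Qed.

HB.instance Definition _ := SemiGroup.isLaw.Build X label_add label_addA.

Definition label_add_law : SemiGroup.law X := label_add.

Lemma conj_o_label_add a b : conj_o label_add_law a b <-> c a = c b.
Proof.
split=> [[g [_ [/(congr1 c) + _]]]|cab]; last first.
  by exists a, a; rewrite /= /label_add cab.
(* The label of [g] cancels modulo [k], and labels are already reduced. *)
by rewrite !label_addE addnC => /eqP; rewrite eqn_modDl !c_mod => /eqP.
Qed.

Lemma conj_c_label_add a b : ~ (forall x y, c x = c y) ->
  conj_c label_add_law a b <-> c a = c b.
Proof.
move=> c_nconst; rewrite -conj_o_label_add.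
have PPT x g : PP label_add_law x g.
  move=> z [z0 zx0]; exfalso; apply: c_nconst => x' y'.
  by apply/conj_o_label_add; exists z, z; rewrite !z0 !zx0.
split=> [[g [h [_ _ + +]]]|[g [h [ag bh]]]]; last first.
  exists (Some g), (Some h); split; rewrite /= ?ag ?bh//; left.
  - by exists g.
  - by exists h.
(* If [g] or [h] is the adjoined identity [None], then [a = b], and an element of the semigroup can
   replace it. *)
case: g => [g|] /=; last by move=> [<-] _; exists a, a.
case: h => [h|] /=; last by move=> _ [<-]; exists b, b.
by move=> [ag] [bh]; exists g, h.
Qed.

End LabelsAddition.

Lemma partition_covering_chain (R : conjugacy) (X : Type) :
  (forall (c : X -> nat) a b, R X (chain_law c) a b <-> c a = c b) ->
  countable [set: X] -> partition_covering R X.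
Proof.
move=> RE cX P /(partition_labelling cX)[c [_ [PE _ _]]].
by exists (chain_law c); exact: covering_labelling PE (RE c).
Qed.

Lemma partition_covering_label_add (R : conjugacy) (X : Type) :
  (forall c : X -> nat, (forall x y, c x = c y) ->
    forall a b, R X (chain_law c) a b) ->
  (forall (c : X -> nat) k r (c_mod : forall x, c x %% k = c x)
      (rK : forall n, c (r n) = n %% k),
    ~ (forall x y, c x = c y) ->
    forall a b, R X (label_add_law rK) a b <-> c a = c b) ->
  countable [set: X] -> partition_covering R X.
Proof.
move=> Rchain Radd cX P /(partition_labelling cX)[c [k [PE c_mod c_onto]]].
(* With a single block, [label_add] would be a null multiplication, for which [conj_c] is mere
   equality; hence the left zero band. Empty [X] falls under this case too. *)
have [c_const|c_nconst] := pselect (forall x y, c x = c y).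
  exists (chain_law c); apply: covering_labelling PE _ => a b.
  by split=> _; [exact: c_const|exact: Rchain].
have [x0] : exists x0 : X, True.
  by apply: contrapT => X0; apply: c_nconst => x; case: X0; exists x.
move=> _; have /choice[r rK] := c_onto x0.
by exists (label_add_law rK); apply: covering_labelling PE _; exact: Radd.
Qed.

Theorem theorem5p1 :
  (forall X : Type, countable [set: X] ->
     partition_covering conj_o X /\ partition_covering conj_c X) /\
  (forall X : Type, finite_set [set: X] ->
     [/\ partition_covering conj_p X, partition_covering conj_pstar X
       & partition_covering conj_tr X]).
Proof.
split=> [X cX|X /finite_set_countable cX].
  split; apply: partition_covering_label_add cX.
  - exact: conj_o_chain.
  - by move=> c k r c_mod rK _ a b; exact: conj_o_label_add.
  - exact: conj_c_chain.
  - by move=> c k r c_mod rK c_nconst a b; exact: conj_c_label_add.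
split; apply: partition_covering_chain cX => c.
- exact: conj_p_chain.
- exact: conj_pstar_chain.
- exact: conj_tr_chain.
Qed.
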